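(* Let $\lambda=(\lambda_k)_{k\ge 0}$ be a strictly increasing sequence of positive real numbers tending to $\infty$, with $\lambda_{-1}=0$, and let $p=(p_k)_{k\ge 0}$ be a sequence of real numbers with $0<p_k\le H<\infty$ for all $k$. Then the sequence space $\ell(\lambda,p)$ is linearly isomorphic to the space $\ell(p)$.
   Context: For a real sequence $x=(x_k)_{k\ge0}$ put $\Lambda_n(x)=\frac{1}{\lambda_n}\sum_{k=0}^{n}(\lambda_k-\lambda_{k-1})x_k$. Define $\ell(p)=\{x\in\mathbb{R}^{\mathbb{N}}:\sum_{n=0}^\infty|x_n|^{p_n}<\infty\}$ and $\ell(\lambda,p)=\{x\in\mathbb{R}^{\mathbb{N}}:\sum_{n=0}^\infty|\Lambda_n(x)|^{p_n}<\infty\}$, both linear spaces under coordinatewise operations. ''Linearly isomorphic'' means that there exists a linear bijection between the two spaces. *)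

(* Defs.v *)
From HB Require Import structures.
From mathcomp Require Import all_boot all_order all_algebra.
From mathcomp Require Import all_classical all_reals all_analysis.
Set Implicit Arguments.
Unset Strict Implicit.
Unset Printing Implicit Defensive.
Import Order.TTheory GRing.Theory Num.Theory.
Import numFieldNormedType.Exports.
Local Open Scope classical_set_scope.
Local Open Scope ring_scope.

Section Spaces.
Context {R : realType}.
Implicit Types (lam p x y : nat -> R).

(* [lam_{k-1}], with the convention [lam_{-1} = 0]. *)
Definition lam_pred lam (k : nat) : R := if k is j.+1 then lam j else 0.

Definition Lambda lam x (n : nat) : R :=
  (lam n)^-1 * \sum_(0 <= k < n.+1) (lam k - lam_pred lam k) * x k.

(* The series below have nonnegative terms, so they always have a value in
   [0, +oo]. Moreover [0 `^ r = 0] for [r != 0], hence for the positive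
   exponents considered here. *)
Definition ell p : set (nat -> R) :=
  [set x | (\sum_(0 <= n <oo) (`|x n| `^ p n)%:E < +oo)%E].

Definition ell_lambda lam p : set (nat -> R) :=
  [set x | (\sum_(0 <= n <oo) (`|Lambda lam x n| `^ p n)%:E < +oo)%E].

Lemma LambdaP lam a x y n :
  Lambda lam (a *: x + y) n = a * Lambda lam x n + Lambda lam y n.
Proof.
rewrite /Lambda mulrCA -mulrDr; congr (_ * _).
rewrite mulr_sumr -big_split /=; apply: eq_bigr => k _.
by rewrite mulrDr mulrCA.
Qed.

Lemma ell_lambdaE lam p x : ell_lambda lam p x = ell p (Lambda lam x).
Proof. by []. Qed.

Lemma Lambda0 lam : Lambda lam 0 = 0.
Proof.
apply/funext => n; rewrite /Lambda big1 ?mulr0// => k _.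
by rewrite mulr0.
Qed.

Section Linear.
Variables (p : nat -> R) (H : R).
Hypothesis hp : forall k, 0 < p k <= H.

Lemma powR_lin_le a u v n :
  `|a * u + v| `^ p n <=
  (2 * Num.max `|a| 1) `^ H * (`|u| `^ p n + `|v| `^ p n).
Proof.
have /andP[p0 pH] := hp n.
set M := Num.max `|a| 1; set w := Num.max `|u| `|v|.
have aM : `|a| <= M by rewrite le_max lexx.
have M1 : 1 <= M by rewrite le_max lexx orbT.
have M0 : 0 <= M by apply: le_trans M1.
have uw : `|u| <= w by rewrite le_max lexx.
have vw : `|v| <= w by rewrite le_max lexx orbT.
have w0 : 0 <= w by apply: le_trans uw.
have M21 : 1 <= 2 * M by rewrite -[leLHS]mulr1 ler_pM ?ler1n.
have le1 : `|a * u + v| <= 2 * M * w.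
  apply: (le_trans (ler_normD _ _)); rewrite normrM -mulrA mulr_natl mulr2n.
  apply: lerD; first exact: ler_pM.
  by rewrite -[`|v|]mul1r ler_pM.
have le2 : `|a * u + v| `^ p n <= (2 * M * w) `^ p n.
  by apply: ge0_ler_powR; rewrite ?nnegrE ?mulr_ge0 ?(ltW p0).
apply: (le_trans le2); rewrite powRM ?mulr_ge0//.
apply: ler_pM; rewrite ?powR_ge0 ?ler_powR//.
by rewrite /w; case: (leP `|u| `|v|) => _; rewrite ?lerDl ?lerDr powR_ge0.
Qed.

Lemma ell_linear a x y : ell p x -> ell p y ->
  ell p (fun n => a * x n + y n).
Proof.
rewrite /ell /= => hx hy.
set C := (2 * Num.max `|a| 1) `^ H.
have pge0 z i : (0 <= (`|z i| `^ p i)%:E)%E by rewrite lee_fin powR_ge0.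
apply: (@le_lt_trans _ _
  (\sum_(0 <= n <oo) (C%:E * ((`|x n| `^ p n)%:E + (`|y n| `^ p n)%:E)))%E).
  apply: lee_nneseries => [i _ _|n _]; first by rewrite lee_fin powR_ge0.
  by rewrite -EFinD -EFinM lee_fin powR_lin_le.
rewrite nneseriesZl; last by move=> i _; rewrite adde_ge0.
rewrite nneseriesD//.
by rewrite lte_mul_pinfty ?lee_fin ?powR_ge0// lte_add_pinfty.
Qed.

Lemma ell_zero : ell p 0.
Proof.
rewrite /ell /= eseries0 ?ltry// => n _ _.
by have /andP[p0 _] := hp n; rewrite normr0 powR0// gt_eqF.
Qed.

End Linear.

(* Vector-space structure: the spaces are closed under the coordinatewise
   operations of [nat -> R] because the exponents are positive and bounded,
   so this hypothesis is an argument of the types. *)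
Definition ell_mem p H of (forall k, 0 < p k <= H) : {pred (nat -> R)} :=
  mem (ell p).

Definition ell_lambda_mem lam p H of (forall k, 0 < p k <= H) :
  {pred (nat -> R)} := mem (ell_lambda lam p).

Lemma ell_submod_closed p H (hp : forall k, 0 < p k <= H) :
  submod_closed (ell_mem hp).
Proof.
split; first by rewrite inE; exact: ell_zero hp.
by move=> a x y; rewrite !inE; exact: ell_linear hp _ _ _.
Qed.

HB.instance Definition _ p H (hp : forall k, 0 < p k <= H) :=
  GRing.isSubmodClosed.Build R (nat -> R) (ell_mem hp) (ell_submod_closed hp).

Lemma ell_lambda_submod_closed lam p H (hp : forall k, 0 < p k <= H) :
  submod_closed (ell_lambda_mem lam hp).
Proof.
split; first by rewrite inE ell_lambdaE Lambda0; exact: ell_zero hp.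
move=> a x y; rewrite !inE !ell_lambdaE => hx hy.
rewrite (_ : Lambda _ _ = fun n => a * Lambda lam x n + Lambda lam y n).
  exact: ell_linear hp _ _ _ hx hy.
by apply/funext => n; rewrite LambdaP.
Qed.

HB.instance Definition _ lam p H (hp : forall k, 0 < p k <= H) :=
  GRing.isSubmodClosed.Build R (nat -> R) (ell_lambda_mem lam hp)
    (ell_lambda_submod_closed lam hp).

Record ell_space p H (hp : forall k, 0 < p k <= H) := EllSpace {
  ell_val :> nat -> R;
  _ : ell_val \in ell_mem hp }.

Record ell_lambda_space lam p H (hp : forall k, 0 < p k <= H) :=
  EllLambdaSpace {
    ell_lambda_val :> nat -> R;
    _ : ell_lambda_val \in ell_lambda_mem lam hp }.

Section Instances.
Variables (lam p : nat -> R) (H : R) (hp : forall k, 0 < p k <= H).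

HB.instance Definition _ := [isSub for @ell_val p H hp].
HB.instance Definition _ := [Choice of ell_space hp by <:].
HB.instance Definition _ := [SubChoice_isSubLmodule of ell_space hp by <:].

HB.instance Definition _ := [isSub for @ell_lambda_val lam p H hp].
HB.instance Definition _ := [Choice of ell_lambda_space lam hp by <:].
HB.instance Definition _ :=
  [SubChoice_isSubLmodule of ell_lambda_space lam hp by <:].

End Instances.

End Spaces.

Definition linearly_isomorphic (R : pzRingType) (V W : lmodType R) : Prop :=
  exists f : {linear V -> W}, bijective f.

(* Main.v *)
Require Import Defs.
From HB Require Import structures.
From mathcomp Require Import all_boot all_order all_algebra.
From mathcomp Require Import all_classical all_reals all_analysis.
Set Implicit Arguments.
Unset Strict Implicit.
Unset Printing Implicit Defensive.
Import Order.TTheory GRing.Theory Num.Theory.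
Import numFieldNormedType.Exports.
Local Open Scope classical_set_scope.
Local Open Scope ring_scope.

(** By definition [ell_lambda lam p] is the preimage of [ell p] under the linear map [Lambda lam],
    so it suffices that [Lambda lam] be a bijection of the space of all sequences. It is:
    [lam n * Lambda lam x n] is a partial sum with weights [lam k - lam_pred lam k], nonzero since
    [lam] is positive and strictly increasing, so differencing recovers [x] ([LambdaK]) and
    telescoping gives the converse ([Lambda_invK]). *)

Section LambdaInverse.
Context {R : realType}.
Variable lam : nat -> R.
Implicit Types x y : nat -> R.

(* At [k = 0] the junk term [y 0.-1] is multiplied by [lam_{-1} = 0]. *)
Definition Lambda_inv y (k : nat) : R :=
  (lam k * y k - lam_pred lam k * y k.-1) / (lam k - lam_pred lam k).

Hypothesis lam_neq0 : forall k, lam k != 0.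
Hypothesis lam_step_neq0 : forall k, lam k - lam_pred lam k != 0.

Lemma mul_Lambda x n :
  lam n * Lambda lam x n =
  \sum_(0 <= k < n.+1) (lam k - lam_pred lam k) * x k.
Proof. by rewrite /Lambda mulVKf. Qed.

(** Two consecutive partial sums differ by the single term [(lam k - lam_pred lam k) * x k]. *)
Lemma LambdaK : cancel (Lambda lam) Lambda_inv.
Proof.
move=> x; apply/funext => -[|n]; apply: (canLR (mulfK (lam_step_neq0 _))) => /=.
  by rewrite mul_Lambda big_nat1 mul0r subr0 mulrC.
by rewrite !mul_Lambda [in LHS]big_nat_recr//= addrAC subrr add0r mulrC.
Qed.

Lemma Lambda_invK : cancel Lambda_inv (Lambda lam).
Proof.
move=> y; apply/funext => n; apply: (mulfI (lam_neq0 n)); rewrite mul_Lambda.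
(* The weight cancels the denominator of [Lambda_inv], leaving a sum that telescopes to
   [lam n * y n], its lower end vanishing because [lam_pred lam 0] is 0. *)
under eq_bigr do rewrite mulrC divfK//.
elim: n => [|n IHn]; first by rewrite big_nat1 mul0r subr0.
by rewrite big_nat_recr//= IHn addrC subrK.
Qed.

End LambdaInverse.

Section LambdaSpace.
Context {R : realType}.
Variables (lam p : nat -> R) (H : R) (hp : forall k, 0 < p k <= H).

(** [valP x] serves as the membership proof because the two membership conditions are
    convertible. *)
Definition Lambda_space (x : ell_lambda_space lam hp) : ell_space hp :=
  @EllSpace R p H hp (Lambda lam (val x)) (valP x).

Lemma Lambda_space_is_linear : linear Lambda_space.
Proof. by move=> a x y; apply/val_inj/funext => n; exact: LambdaP. Qed.

HB.instance Definition _ := GRing.isLinear.Build R _ _ _ Lambda_space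
  Lambda_space_is_linear.

End LambdaSpace.

Theorem theorem2 (R : realType) (lam p : nat -> R) (H : R)
    (lam_gt0 : forall k, 0 < lam k)
    (lam_increasing : {homo lam : m n / (m < n)%N >-> m < n})
    (lam_infty : lam n @[n --> \oo] --> +oo)
    (hp : forall k, 0 < p k <= H) :
  linearly_isomorphic (ell_lambda_space lam hp) (ell_space hp).
Proof.
have lam_neq0 k : lam k != 0 by rewrite gt_eqF.
have step_neq0 k : lam k - lam_pred lam k != 0.
  by rewrite gt_eqF// subr_gt0; case: k => //= k; exact: lam_increasing.
have LK := LambdaK lam_neq0 step_neq0.
have LinvK := Lambda_invK lam_neq0 step_neq0.
(* The inverse lands in the right space: applying [Lambda lam] to [Lambda_inv lam y] gives back [y],
   which lies in [ell p]. *)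
have inv_mem (y : ell_space hp) :
    Lambda_inv lam (val y) \in ell_lambda_mem lam hp.
  by have := valP y; rewrite !inE ell_lambdaE LinvK.
exists (@Lambda_space R lam p H hp).
exists (fun y => EllLambdaSpace (inv_mem y)) => [x|y]; apply: val_inj.
  exact: LK.
exact: LinvK.
Qed.
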